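(* Suppose that the error estimator satisfies stability on non-refined element domains, reduction on refined element domains, reliability, and discrete reliability, that $b(\cdot,\cdot)$ is definite on $\mathcal X_\infty$ (all as defined in the context), and that $\mathcal X_\infty=\mathcal H$. Let $\widehat\gamma_0>0$ be the lower bound of the inf-sup constants associated with the uniform refinement $\widehat{\mathcal T}_0$ of $\mathcal T_0$, let $\ell_3,\ell_5\in\mathbb N_0$ be the indices fixed in the context, and define $\ell_6:=\max\{\ell_3,\ell_5\}$. Let $$0<\theta<\theta_{\rm opt}:=\big(1+C_{\rm stb}^2C_{\rm rel}^2/\widehat\gamma_0^2\big)^{-1}.$$ Then, for all $s>0$, there exists a constant $C_{\rm opt}>0$ such that $$\|u\|_{\mathbb A_s}<\infty\quad\Longleftrightarrow\quad\forall\ell\ge\ell_6:\ \ \eta_\ell\le C_{\rm opt}\,\big(\#\mathcal T_\ell-\#\mathcal T_0+1\big)^{-s}.$$ The constant $C_{\rm opt}$ depends only on $\#\mathcal T_{\ell_6}$, $\mathcal T_0$, $\theta$, $s$, and the validity of the five assumptions (stability, reduction, reliability, discrete reliability, definiteness).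
   Context: Problem. Let $\mathbb K\in\{\mathbb R,\mathbb C\}$ and let $\mathcal H$ be a separable Hilbert space over $\mathbb K$ with norm $\|\cdot\|_{\mathcal H}$, dual space $\mathcal H^*$ and duality pairing $\langle\cdot,\cdot\rangle$ on $\mathcal H^*\times\mathcal H$ (antilinear in the second argument if $\mathbb K=\mathbb C$). Let $a(\cdot,\cdot)$ be a hermitian, continuous sesquilinear form on $\mathcal H$ that is elliptic: there is $\alpha>0$ with $\alpha\|v\|_{\mathcal H}^2\le a(v,v)$ for all $v\in\mathcal H$; write $\|v\|_a:=a(v,v)^{1/2}$. Let $\mathcal K:\mathcal H\to\mathcal H^*$ be a compact linear operator, $f\in\mathcal H^*$, and $b(w,v):=a(w,v)+\langle\mathcal Kw,v\rangle$. The problem $b(u,v)=\langle f,v\rangle$ for all $v\in\mathcal H$ is assumed to be well-posed, i.e., for $w\in\mathcal H$: $w=0$ if and only if $b(w,v)=0$ for all $v\in\mathcal H$; $u\in\mathcal H$ denotes its unique solution. For a finite-dimensional subspace $\mathcal X_\bullet\subset\mathcal H$, the discrete problem is: find $U_\bullet\in\mathcal X_\bullet$ with $b(U_\bullet,V_\bullet)=\langle f,V_\bullet\rangle$ for all $V_\bullet\in\mathcal X_\bullet$. It may fail to have a unique solution; ''$U_\bullet$ exists'' means that a unique solution exists. The inf-sup constant of $\mathcal X_\bullet$ is $\gamma_\bullet:=\inf_{W\in\mathcal X_\bullet\setminus\{0\}}\sup_{V\in\mathcal X_\bullet\setminus\{0\}}\frac{|b(W,V)|}{\|W\|_{\mathcal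 H}\|V\|_{\mathcal H}}$. Meshes. $\Omega\subset\mathbb R^d$ ($d\ge2$) is a polygonal/polyhedral Lipschitz domain; $\mathcal T_0$ is a given conforming initial triangulation; the local mesh-size of $\mathcal T_\bullet$ is $h_\bullet|_T:=|T|^{1/d}$. A fixed refinement strategy (e.g. newest vertex bisection) is given: for a conforming triangulation $\mathcal T_\star$ and $\mathcal M_\star\subseteq\mathcal T_\star$, $\mathcal T_\bullet={\rm refine}(\mathcal T_\star,\mathcal M_\star)$ is the coarsest (minimal number of elements) conforming triangulation such that every $T\in\mathcal T_\star$ is the union of the elements of $\mathcal T_\bullet$ contained in it and $\mathcal M_\star\subseteq\mathcal T_\star\setminus\mathcal T_\bullet$. $\mathcal T_\bullet\in{\rm refine}(\mathcal T_\star)$ means $\mathcal T_\bullet$ is obtained from $\mathcal T_\star$ by finitely many (possibly zero) such steps, and $\mathbb T:={\rm refine}(\mathcal T_0)$. There is $0<q_{\rm mesh}<1$ such that $\mathcal T_\bullet\in{\rm refine}(\mathcal T_\star)$ implies $h_\bullet|_T\le q_{\rm mesh}h_\star|_T$ for all $T\in\mathcal T_\star\setminus\mathcal T_\bullet$. Each $\mathcal T_\star\in\mathbb T$ has an associated finite-dimensional subspace $\mathcal X_\star\subset\mathcal H$, and $\mathcal T_\bullet\in{\rm refine}(\mathcal T_\star)$ implies $\mathcal X_\star\subseteq\mathcal X_\bullet$. Uniform refinement means marking all elements; for every sequence $\widehat{\mathcal T}^{(0)}=\mathcal T_0$, $\widehat{\mathcal T}^{(\ell+1)}={\rm refine}(\widehat{\mathcal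 T}^{(\ell)},\widehat{\mathcal M}^{(\ell)})$ with $\widehat{\mathcal M}^{(\ell)}=\widehat{\mathcal T}^{(\ell)}$ for infinitely many $\ell$, the union of the corresponding spaces is dense in $\mathcal H$. Estimator. Whenever $\mathcal T_\star\in\mathbb T$ and $U_\star$ exists, refinement indicators $\eta_\star(T)\ge0$, $T\in\mathcal T_\star$, are given; $\eta_\star(\mathcal U):=(\sum_{T\in\mathcal U}\eta_\star(T)^2)^{1/2}$ for $\mathcal U\subseteq\mathcal T_\star$ and $\eta_\star:=\eta_\star(\mathcal T_\star)$. Adaptive algorithm. Input: $0<\theta\le1$, $C_{\rm mark}\ge1$, $\mathcal T_0$, $U_{-1}:=0$, $\eta_{-1}:=1$. For $\ell=0,1,2,\dots$: if the discrete problem has no unique solution in $\mathcal X_\ell$, set $U_\ell:=U_{\ell-1}$, $\eta_\ell:=\eta_{\ell-1}$, $\mathcal T_{\ell+1}:={\rm refine}(\mathcal T_\ell,\mathcal T_\ell)$ and go to the next $\ell$. Otherwise compute the unique solution $U_\ell\in\mathcal X_\ell$ and the indicators $\eta_\ell(T)$, determine $\mathcal M_\ell\subseteq\mathcal T_\ell$ of (up to the multiplicative constant $C_{\rm mark}$) minimal cardinality such that $\theta\eta_\ell^2\le\eta_\ell(\mathcal M_\ell)^2$ (Dörfler marking), and set $\mathcal T_{\ell+1}:={\rm refine}(\mathcal T_\ell,\mathcal M_\ell)$. The output is the sequences $\mathcal T_\ell,U_\ell,\eta_\ell$; $\mathcal X_\infty:=\overline{\bigcup_{\ell\ge0}\mathcal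 X_\ell}$. Assumptions named in the claim. Stability: there is $C_{\rm stb}>0$ such that for all $\mathcal T_\star\in\mathbb T$, $\mathcal T_\bullet\in{\rm refine}(\mathcal T_\star)$ for which $U_\star,U_\bullet$ exist, $|\eta_\bullet(\mathcal T_\bullet\cap\mathcal T_\star)-\eta_\star(\mathcal T_\bullet\cap\mathcal T_\star)|\le C_{\rm stb}\|U_\bullet-U_\star\|_{\mathcal H}$. Reduction: there are $C_{\rm red}>0$, $0<q_{\rm red}<1$ such that for all such $\mathcal T_\star,\mathcal T_\bullet$, $\eta_\bullet(\mathcal T_\bullet\setminus\mathcal T_\star)^2\le q_{\rm red}\eta_\star(\mathcal T_\star\setminus\mathcal T_\bullet)^2+C_{\rm red}^2\|U_\bullet-U_\star\|_{\mathcal H}^2$. Reliability: there is $C_{\rm rel}'>0$ such that $\|u-U_\star\|_{\mathcal H}\le C_{\rm rel}'\eta_\star$ for all $\mathcal T_\star\in\mathbb T$ for which $U_\star$ exists. Discrete reliability: there is $C_{\rm rel}>0$ such that for all $\mathcal T_\star\in\mathbb T$ and $\mathcal T_\bullet\in{\rm refine}(\mathcal T_\star)$ there is a set $\mathcal R_{\star,\bullet}\subseteq\mathcal T_\star$ such that, if $U_\star,U_\bullet$ exist, $\|U_\bullet-U_\star\|_{\mathcal H}\le C_{\rm rel}\gamma_\bullet^{-1}\eta_\star(\mathcal R_{\star,\bullet})$, $\mathcal T_\star\setminus\mathcal T_\bullet\subseteq\mathcal R_{\star,\bullet}$ and $\#\mathcal R_{\star,\bullet}\le C_{\rm rel}\#(\mathcal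 T_\star\setminus\mathcal T_\bullet)$. Definiteness on $\mathcal X_\infty$: if $w\in\mathcal X_\infty$ and $b(w,v)=0$ for all $v\in\mathcal X_\infty$, then $w=0$. Fine properties of the refinement (standing; all satisfied by newest vertex bisection). (Sons) Each refined element is split into at least 2 and at most $C_{\rm son}$ sons; in particular $\#(\mathcal T_\star\setminus\mathcal T_\bullet)+\#\mathcal T_\star\le\#\mathcal T_\bullet$ for $\mathcal T_\star\in\mathbb T$, $\mathcal T_\bullet\in{\rm refine}(\mathcal T_\star)$. (Closure) $\#\mathcal T_\ell-\#\mathcal T_0\le C_{\rm mesh}\sum_{j=0}^{\ell-1}\#\mathcal M_j$ for all $\ell\in\mathbb N$, whenever $\mathcal T_{j+1}={\rm refine}(\mathcal T_j,\mathcal M_j)$, with $C_{\rm mesh}\ge1$ depending only on $\mathcal T_0$. (Overlay) For $\mathcal T\in\mathbb T$ and $\mathcal T_\bullet,\mathcal T_\star\in{\rm refine}(\mathcal T)$ there is a common refinement $\mathcal T_\bullet\oplus\mathcal T_\star\in{\rm refine}(\mathcal T_\bullet)\cap{\rm refine}(\mathcal T_\star)$ with $\#(\mathcal T_\bullet\oplus\mathcal T_\star)\le\#\mathcal T_\bullet+\#\mathcal T_\star-\#\mathcal T$. The mesh $\widehat{\mathcal T}_0$. There is (and we fix) $m\in\mathbb N$ such that the $m$-times uniform refinement $\widehat{\mathcal T}_0$ of $\mathcal T_0$ has the following properties: there is $\widehat\gamma_0>0$ with $\gamma_\bullet\ge\widehat\gamma_0$ for all $\mathcal T_\bullet\in{\rm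 refine}(\widehat{\mathcal T}_0)$ (so $U_\bullet$ exists and $\|u-U_\bullet\|_{\mathcal H}\le C\min_{V\in\mathcal X_\bullet}\|u-V\|_{\mathcal H}$ with uniform $C$); there is $C_{\rm mon}>0$ with $\eta_\bullet\le C_{\rm mon}\eta_\star$ for all $\mathcal T_\star\in\mathbb T$ for which $U_\star$ exists and all $\mathcal T_\bullet\in{\rm refine}(\widehat{\mathcal T}_0)\cap{\rm refine}(\mathcal T_\star)$; for every $\mathcal T_\star\in\mathbb T$ the $m$-times uniform refinement $\widehat{\mathcal T}_\star$ of $\mathcal T_\star$ satisfies $\widehat{\mathcal T}_\star\in{\rm refine}(\widehat{\mathcal T}_0)$ and $\#\widehat{\mathcal T}_\star\le C_{\rm son}^m\#\mathcal T_\star$. Indices. If $\mathcal X_\infty=\mathcal H$, there is an index $\ell_5\in\mathbb N_0$ (fixed) with $\mathcal T_\ell\in{\rm refine}(\widehat{\mathcal T}_0)$ for all $\ell\ge\ell_5$. The index $\ell_3\in\mathbb N_0$ is such that, for a suitably fixed $0<\varepsilon<1$, $\|u-U_{\ell+1}\|_a^2+\|U_{\ell+1}-U_\ell\|_a^2\le\frac1{1-\varepsilon}\|u-U_\ell\|_a^2$ for all $\ell\ge\ell_3$, and such that for some $C_{\rm lin}>0$, $0<q_{\rm lin}<1$ one has $\eta_{\ell+n}\le C_{\rm lin}q_{\rm lin}^n\eta_\ell$ for all $\ell\ge\ell_3$, $n\in\mathbb N_0$ (such $\varepsilon$ and $\ell_3$ exist under the five assumptions above). Approximation class. For $N\in\mathbb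 N_0$, $\mathbb T_N:=\{\mathcal T_\star\in\mathbb T:\#\mathcal T_\star-\#\mathcal T_0\le N\text{ and }U_\star\text{ exists}\}$, with the convention $\min_{\mathcal T_\star\in\mathbb T_N}\eta_\star=0$ if $\mathbb T_N=\emptyset$, and for $s>0$, $\|u\|_{\mathbb A_s}:=\sup_{N\in\mathbb N_0}\big((N+1)^s\min_{\mathcal T_\star\in\mathbb T_N}\eta_\star\big)$.
   Formalization: The constant C_opt may depend, besides the listed quantities, also on ‖u‖_{A_s} and on the estimator value on the mesh T̂_0; otherwise the claim fails, since scaling f by λ multiplies every η_ℓ by λ but leaves meshes, indices and all constants of the assumptions unchanged. *)

(* Defs.v *)
From HB Require Import structures.
From mathcomp Require Import all_boot all_order all_algebra.
From mathcomp Require Import finmap complex.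
From mathcomp Require Import all_classical all_reals all_analysis.

Set Implicit Arguments.
Unset Strict Implicit.
Unset Printing Implicit Defensive.

Import Order.TTheory GRing.Theory Num.Theory.
Import numFieldNormedType.Exports.

Local Open Scope classical_set_scope.
Local Open Scope ring_scope.

Inductive base_field := RealScalars | ComplexScalars.

Definition scalars (R : realType) (k : base_field) : numFieldType :=
  match k with RealScalars => R | ComplexScalars => R[i] end.

Definition conjs (R : realType) (k : base_field) :
    scalars R k -> scalars R k :=
  match k with RealScalars => fun x => x | ComplexScalars => @conjc R end.

Definition res (R : realType) (k : base_field) : scalars R k -> R :=
  match k with RealScalars => fun x => x | ComplexScalars => @complex.Re R end.

(* Norms over [scalars R k] take their values in [scalars R k]; [rnorm] is the
   same norm seen as a real number. *)
Definition rnorm (R : realType) (k : base_field)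
  (V : normedZmodType (scalars R k)) (v : V) : R := res `|v|.

(* [D] represents the dual of [H] through [p] : the functionals [p g] are
   exactly the continuous antilinear ones, and the norm of [D] is the operator
   norm.  Injectivity of [p] follows from the last clause. *)
Definition is_dual (R : realType) (k : base_field)
    (H D : normedModType (scalars R k))
    (p : {bilinear D -> H -> scalars R k | *%R & @conjs R k \; *%R}) : Prop :=
  [/\ forall g : D, continuous (p g : H -> (scalars R k)^o),
      forall phi : H -> (scalars R k)^o,
        (forall (c : scalars R k) x y,
            phi (c *: x + y) = conjs c * phi x + phi y) ->
        continuous phi -> exists g : D, forall v, p g v = phi v
    & forall g : D,
        rnorm g = sup [set rnorm (p g v : scalars R k) | v in
                         [set v : H | rnorm v <= 1]]].

Definition is_compact_operator (R : realType) (k : base_field)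
    (V W : normedModType (scalars R k)) (A : V -> W) : Prop :=
  forall B : set V, bounded_set B -> precompact (A @` B).

Record problem (R : realType) := Problem {
  pb_field : base_field ;
  pb_H : completeNormedModType (scalars R pb_field) ;
  pb_inner : {dot pb_H for @conjs R pb_field} ;
  pb_innerE : forall v : pb_H, `|v| ^+ 2 = pb_inner v v ;
  pb_separable : exists2 A : set pb_H, countable A & dense A ;
  pb_dual : normedModType (scalars R pb_field) ;
  pb_pairing : {bilinear pb_dual -> pb_H -> scalars R pb_field |
                  *%R & @conjs R pb_field \; *%R} ;
  pb_dualP : is_dual pb_pairing ;
  pb_a : {hermitian_sym pb_H for @conjs R pb_field} ;
  pb_a_continuous :
    continuous (fun p : pb_H * pb_H => pb_a p.1 p.2 : (scalars R pb_field)^o) ;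
  pb_a_elliptic : exists2 alpha : scalars R pb_field,
    0 < alpha & forall v : pb_H, alpha * `|v| ^+ 2 <= pb_a v v ;
  pb_K : {linear pb_H -> pb_dual} ;
  pb_K_compact : is_compact_operator pb_K ;
  pb_f : pb_dual ;
  pb_b := fun w v : pb_H => pb_a w v + pb_pairing (pb_K w) v ;
  pb_wellposed : forall w : pb_H, w = 0 <-> forall v, pb_b w v = 0 ;
  pb_u : pb_H ;
  pb_uP : forall v : pb_H, pb_b pb_u v = pb_pairing pb_f v
}.

Section DiscreteProblem.
Variables (R : realType) (P : problem R).
Implicit Types X : set (pb_H P).

Definition normH (v : pb_H P) : R := rnorm v.

Definition normA (v : pb_H P) : R := Num.sqrt (res (pb_a P v v)).

Definition findim_subspace X : Prop :=
  exists (n : nat) (e : 'I_n -> pb_H P),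
    X = [set \sum_i c i *: e i | c in [set: 'I_n -> scalars R (pb_field P)]].

Definition discrete_solution X (U : pb_H P) : Prop :=
  X U /\ forall V, X V -> pb_b U V = pb_pairing P (pb_f P) V.

Definition solvable X : Prop := exists! U, discrete_solution X U.

(* Only meaningful when [solvable X]. *)
Definition galerkin X : pb_H P := get (discrete_solution X).

(* Equal to +oo for the trivial space. *)
Definition infsup X : \bar R :=
  ereal_inf [set ereal_sup
    [set (rnorm (pb_b W V : scalars R (pb_field P)) / (normH W * normH V))%:E
       | V in X `\ 0] | W in X `\ 0].

Definition definite_on X : Prop :=
  forall w, X w -> (forall v, X v -> pb_b w v = 0) -> w = 0.

End DiscreteProblem.

Section Triangulations.
Variables (R : realType) (d : nat).
Local Notation point := 'rV[R]_d.

(* A simplex is given by its finite set of vertices. *)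
Definition element := {fset point}.
Definition mesh := {fset element}.

Definition body (t : element) : set point :=
  [set x | exists c : point -> R,
     [/\ forall p, 0 <= c p, \sum_(p <- t) c p = 1
       & x = \sum_(p <- t) c p *: p]].

Definition affinely_independent (t : element) : Prop :=
  forall c : point -> R,
    \sum_(p <- t) c p = 0 -> \sum_(p <- t) c p *: p = 0 ->
    forall p, p \in t -> c p = 0.

Definition conforming_triangulation (Omega : set point) (T : mesh) : Prop :=
  [/\ forall t, t \in T -> #|` t| = d.+1 /\ affinely_independent t,
      closure Omega = \bigcup_(t in [set` T]) body t
    & forall t t', t \in T -> t' \in T ->
        body t `&` body t' = body (t `&` t')%fset].

Definition subdivides (T T' : mesh) : Prop :=
  forall t, t \in T ->
    body t = \bigcup_(t' in [set t' | t' \in T' /\ body t' `<=` body t]) body t'.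

Definition sons (T' : mesh) (t : element) : mesh :=
  [fset t' in T' | `[< (body t' `<=` body t)%classic >]]%fset.

Definition box (a b : point) : set point :=
  [set x | forall i, a 0 i <= x 0 i <= b 0 i].

Definition lebesgue_outer (A : set point) : \bar R :=
  ereal_inf [set (\sum_(0 <= k <oo) (\prod_i ((q.2 k) 0 i - (q.1 k) 0 i))%:E)%E
    | q in [set q : (nat -> point) * (nat -> point) |
             (forall k i, (q.1 k) 0 i <= (q.2 k) 0 i) /\
             A `<=` \bigcup_k box (q.1 k) (q.2 k)]].

Definition meshsize (t : element) : R :=
  fine (lebesgue_outer (body t)) `^ (d%:R^-1).

Definition boundary (Omega : set point) : set point :=
  closure Omega `\` interior Omega.

(* After a rotation by [Q], [Omega] is locally the epigraph of a Lipschitz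
   function [g] of the coordinates other than the [i]-th. *)
Definition lipschitz_boundary (Omega : set point) : Prop :=
  forall x, boundary Omega x ->
    exists (Q : 'M[R]_d) (i : 'I_d) (g : 'rV[R]_(d.-1) -> R),
      [/\ Q *m Q^T = 1%:M, lipschitz (g : _ -> R^o)
        & \forall z \near x,
            Omega z <-> g (col' i (z *m Q)) < (z *m Q) 0 i].

Definition flat_boundary (Omega : set point) : Prop :=
  exists (n : nat) (c : 'I_n -> 'cV[R]_d) (h : 'I_n -> R),
    (forall j, c j != 0) /\
    forall x, boundary Omega x -> exists j, (x *m c j) 0 0 = h j.

Definition polyhedral_lipschitz_domain (Omega : set point) : Prop :=
  [/\ Omega !=set0, open Omega, connected Omega, bounded_set Omega
    & lipschitz_boundary Omega /\ flat_boundary Omega].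

Inductive refines (refine : mesh -> mesh -> mesh) (T : mesh) : mesh -> Prop :=
| refines_refl : refines refine T T
| refines_step (T' M : mesh) :
    refines refine T T' -> (M `<=` T')%fset ->
    refines refine T (refine T' M).

Definition uniform_refine (refine : mesh -> mesh -> mesh) (m : nat) (T : mesh) :=
  iter m (fun T' => refine T' T') T.

(* [rg_refine T M] is only constrained on meshes reachable from [rg_T0], and its
   minimality is among the meshes that the strategy can produce from [T]. *)
Record refinement_setting := RefinementSetting {
  rg_Omega : set point ;
  rg_OmegaP : polyhedral_lipschitz_domain rg_Omega ;
  rg_T0 : mesh ;
  rg_T0P : conforming_triangulation rg_Omega rg_T0 ;
  rg_refine : mesh -> mesh -> mesh ;
  rg_refineP : forall T M : mesh,
    refines rg_refine rg_T0 T -> (M `<=` T)%fset ->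
    [/\ conforming_triangulation rg_Omega (rg_refine T M),
        subdivides T (rg_refine T M),
        (M `<=` T `\` rg_refine T M)%fset
      & forall T', refines rg_refine T T' -> (M `<=` T `\` T')%fset ->
          (#|` rg_refine T M| <= #|` T'|)%N] ;
  rg_qmesh : R ;
  rg_qmesh01 : 0 < rg_qmesh < 1 ;
  rg_meshsize : forall T T' : mesh,
    refines rg_refine rg_T0 T -> refines rg_refine T T' ->
    forall t t', t \in (T `\` T')%fset -> t' \in T' -> body t' `<=` body t ->
      meshsize t' <= rg_qmesh * meshsize t ;
  rg_Cson : nat ;
  rg_sons : forall T M : mesh,
    refines rg_refine rg_T0 T -> (M `<=` T)%fset ->
    forall t, t \in (T `\` rg_refine T M)%fset ->
      (2 <= #|` sons (rg_refine T M) t| <= rg_Cson)%N ;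
  rg_sons_card : forall T T' : mesh,
    refines rg_refine rg_T0 T -> refines rg_refine T T' ->
    (#|` (T `\` T')%fset| + #|` T| <= #|` T'|)%N ;
  rg_Cmesh : R ;
  rg_Cmesh1 : 1 <= rg_Cmesh ;
  rg_closure : forall T M : nat -> mesh,
    T 0%N = rg_T0 ->
    (forall j, (M j `<=` T j)%fset /\ T j.+1 = rg_refine (T j) (M j)) ->
    forall l, #|` T l|%:R - #|` rg_T0|%:R
              <= rg_Cmesh * \sum_(j < l) #|` M j|%:R ;
  rg_overlay : forall T T1 T2 : mesh,
    refines rg_refine rg_T0 T -> refines rg_refine T T1 ->
    refines rg_refine T T2 ->
    exists T', [/\ refines rg_refine T1 T', refines rg_refine T2 T'
      & (#|` T'| + #|` T| <= #|` T1| + #|` T2|)%N]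
}.

End Triangulations.

Section Adaptivity.
Variables (R : realType) (d : nat) (S : refinement_setting R d) (P : problem R).
Local Notation mesh := (mesh R d).
Local Notation element := (element R d).

Local Notation "T' '\in_refine' T" := (refines (rg_refine S) T T')
  (at level 70, no associativity).
Local Notation T0 := (rg_T0 S).

Record discretization := Discretization {
  ds_X : mesh -> set (pb_H P) ;
  ds_findim : forall T, T \in_refine T0 -> findim_subspace (ds_X T) ;
  ds_nested : forall T T',
    T \in_refine T0 -> T' \in_refine T -> ds_X T `<=` ds_X T' ;
  ds_dense : forall T M : nat -> mesh,
    T 0%N = T0 ->
    (forall l, (M l `<=` T l)%fset /\ T l.+1 = rg_refine S (T l) (M l)) ->
    (forall n, exists2 l, (n <= l)%N & M l = T l) ->
    dense (\bigcup_l ds_X (T l)) ;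
  (* [ds_eta T] is only meaningful when [solvable (ds_X T)] *)
  ds_eta : mesh -> element -> R ;
  ds_eta_ge0 : forall T, T \in_refine T0 -> solvable (ds_X T) ->
    forall t, t \in T -> 0 <= ds_eta T t
}.

Variable D : discretization.

Definition has_sol (T : mesh) : Prop := solvable (ds_X D T).
Definition sol (T : mesh) : pb_H P := galerkin (ds_X D T).

Definition eta_on (T U : mesh) : R := Num.sqrt (\sum_(t <- U) ds_eta D T t ^+ 2).
Definition est (T : mesh) : R := eta_on T T.

Definition stability (Cstb : R) : Prop :=
  forall T T', T \in_refine T0 -> T' \in_refine T -> has_sol T -> has_sol T' ->
    `|eta_on T' (T' `&` T)%fset - eta_on T (T' `&` T)%fset|
      <= Cstb * normH (sol T' - sol T).

Definition reduction (Cred qred : R) : Prop :=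
  forall T T', T \in_refine T0 -> T' \in_refine T -> has_sol T -> has_sol T' ->
    eta_on T' (T' `\` T)%fset ^+ 2
      <= qred * eta_on T (T `\` T')%fset ^+ 2
         + Cred ^+ 2 * normH (sol T' - sol T) ^+ 2.

Definition reliability (Crel' : R) : Prop :=
  forall T, T \in_refine T0 -> has_sol T ->
    normH (pb_u P - sol T) <= Crel' * est T.

Definition discrete_reliability (Crel : R) : Prop :=
  forall T T', T \in_refine T0 -> T' \in_refine T ->
    exists2 Rf : mesh, (Rf `<=` T)%fset & (has_sol T -> has_sol T' ->
      [/\ ((normH (sol T' - sol T))%:E
             <= Crel%:E * (infsup (ds_X D T'))^-1 * (eta_on T Rf)%:E)%E,
          (T `\` T' `<=` Rf)%fset
        & #|` Rf|%:R <= Crel * #|` (T `\` T')%fset|%:R]).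

Definition hatT0 (m : nat) : mesh := uniform_refine (rg_refine S) m T0.

Definition hat_mesh_properties (m : nat) (gamma0 Cmon : R) : Prop :=
  [/\ forall T, T \in_refine hatT0 m -> (gamma0%:E <= infsup (ds_X D T))%E,
      forall T T', T \in_refine T0 -> has_sol T ->
        T' \in_refine hatT0 m -> T' \in_refine T -> est T' <= Cmon * est T
    & forall T, T \in_refine T0 ->
        uniform_refine (rg_refine S) m T \in_refine hatT0 m /\
        (#|` uniform_refine (rg_refine S) m T| <= rg_Cson S ^ m * #|` T|)%N].

Definition prev (A : Type) (x : A) (a : nat -> A) (l : nat) : A :=
  if l is l'.+1 then a l' else x.

Definition doerfler (theta : R) (T M : mesh) : Prop :=
  (M `<=` T)%fset /\ theta * est T ^+ 2 <= eta_on T M ^+ 2.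

(* In a step without discrete solution, the set [M l] of marked elements is
   [T l]. *)
Definition adaptive_run (theta Cmark : R) (T M : nat -> mesh)
    (U : nat -> pb_H P) (eta : nat -> R) : Prop :=
  T 0%N = T0 /\
  forall l,
    [/\ has_sol (T l) ->
          [/\ U l = sol (T l), eta l = est (T l), doerfler theta (T l) (M l)
            & forall M', doerfler theta (T l) M' ->
                #|` M l|%:R <= Cmark * #|` M'|%:R],
        ~ has_sol (T l) ->
          [/\ U l = prev 0 U l, eta l = prev 1 eta l & M l = T l]
      & T l.+1 = rg_refine S (T l) (M l)].

Definition Xinfty (T : nat -> mesh) : set (pb_H P) :=
  closure (\bigcup_l ds_X D (T l)).

Definition linear_convergence_index (Clin qlin : R) (U : nat -> pb_H P)
    (eta : nat -> R) (l3 : nat) : Prop :=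
  (exists2 eps : R, 0 < eps < 1 & forall l, (l3 <= l)%N ->
     normA (pb_u P - U l.+1) ^+ 2 + normA (U l.+1 - U l) ^+ 2
       <= (1 - eps)^-1 * normA (pb_u P - U l) ^+ 2) /\
  forall l n, (l3 <= l)%N -> eta (l + n)%N <= Clin * qlin ^+ n * eta l.

Definition meshes_upto (N : nat) : set mesh :=
  [set T | [/\ T \in_refine T0, #|` T|%:R - #|` T0|%:R <= N%:R :> R
             & has_sol T]].

Definition min_est (N : nat) : R :=
  if `[< meshes_upto N = set0 >] then 0 else inf [set est T | T in meshes_upto N].

Definition approx_norm (s : R) : \bar R :=
  ereal_sup [set (N.+1%:R `^ s * min_est N)%:E | N in [set: nat]].

End Adaptivity.

(* Main.v *)
Require Import Defs.
From HB Require Import structures.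
From mathcomp Require Import all_boot all_order all_algebra.
From mathcomp Require Import finmap complex.
From mathcomp Require Import all_classical all_reals all_analysis.
From mathcomp Require Import ring lra zify.

(** The equivalence compares the best rate that any mesh can achieve for a given
number of elements with the rate that the adaptive sequence achieves.

If the adaptive estimators decay at rate [s], then so do the best ones: the
adaptive meshes are themselves competitors.  A given complexity [N] lies between
two consecutive adaptive meshes ([run_crossing]), unless the estimator vanishes
from some step on, and one refinement step multiplies the number of elements by
at most a constant ([card_refine_le]).

Conversely, let the best estimators decay at rate [s].  On the meshes finer than
[hatT0], inf-sup stability makes every discrete problem uniquely solvable
([infsup_solvable]).  Given an adaptive mesh [T l], pick a nearly optimal mesh
whose estimator is a small fraction of [eta l]; this costs of the order of
[eta l `^ (- s^-1)] elements.  Refine it uniformly [m] times, to get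
quasi-monotonicity of the estimator, and overlay it with [T l].  The estimator on
the overlay is at most [kappa * eta l], and such a drop is only possible if the
set that discrete reliability provides, whose cardinality is comparable to the
number of refined elements, carries a fraction [theta] of the squared estimator:
this uses stability and the bound on [theta] ([kappa_marking],
[doerfler_of_drop]).  That set is thus an admissible choice in the marking step,
and the nearly minimal set [M l] has
at most of the order of [eta l `^ (- s^-1)] elements ([run_card_marked]).  The
closure estimate bounds the number of elements of [T l] by the sum of the
cardinalities of the marked sets, and by linear convergence this sum is
dominated by its last term ([linear_convergence_sum], [run_rate]).  Solving for
[eta l] gives the rate. *)

Set Implicit Arguments.
Unset Strict Implicit.
Unset Printing Implicit Defensive.

Import Order.TTheory GRing.Theory Num.Theory.
Import numFieldNormedType.Exports.

Local Open Scope classical_set_scope.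
Local Open Scope ring_scope.

(** * Unique solvability of the discrete problem *)

Section GalerkinLinearAlgebra.
Variables (F : fieldType) (V : lmodType F).
Implicit Types (b : V -> V -> F) (g : V -> F) (conj : F -> F).

Definition spanned_by n (e : 'I_n -> V) : set V :=
  [set \sum_i c i *: e i | c in [set: 'I_n -> F]].

(** A generating family of minimal length is free. *)
Lemma spanned_by_free (X : set V) :
  (exists n (e : 'I_n -> V), X = spanned_by e) ->
  exists n (e : 'I_n -> V), X = spanned_by e /\
    forall c : 'I_n -> F, \sum_i c i *: e i = 0 -> forall i, c i = 0.
Proof.
move=> [n0 [e0 X0]].
pose Q n := `[< exists e : 'I_n -> V, X = spanned_by e >].
have exQ : exists n, Q n by exists n0; apply/asboolP; exists e0.
case: (ex_minnP exQ) => n /asboolP[e Xe] minn.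
exists n, e; split=> // c ce0 i; apply/eqP/negP => /negP ci0.
case: n e Xe c i ce0 ci0 minn => [|n] e Xe c i ce0 ci0 minn; first by case: i {ci0}.
suff /minn : Q n by rewrite ltnn.
apply/asboolP; exists (fun j => e (lift i j)).
have ei : e i = \sum_j (- (c i)^-1 * c (lift i j)) *: e (lift i j).
  move: ce0; rewrite (bigD1_ord i)//= => /eqP; rewrite addr_eq0 => /eqP ce0.
  apply: (scalerI ci0); rewrite ce0 scaler_sumr -sumrN; apply: eq_bigr => j _.
  by rewrite scalerA mulrA mulrN divff// mulN1r scaleNr.
rewrite Xe; apply/seteqP; split=> v [a _ <-]; last first.
  exists (fun j => if unlift i j is Some k then a k else 0) => //.
  rewrite (bigD1_ord i)//= unlift_none scale0r add0r.
  by apply: eq_bigr => j _; rewrite liftK.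
exists (fun j => a (lift i j) - a i * ((c i)^-1 * c (lift i j))) => //.
rewrite (bigD1_ord i)//= ei scaler_sumr -big_split/=; apply: eq_bigr => j _.
by rewrite scalerA -scalerDl mulNr mulrN addrC.
Qed.

Definition skew_linear conj g : Prop :=
  {morph g : u v / u + v} /\ forall a v, g (a *: v) = conj a * g v.

Lemma skew_linear_sum conj g n (c : 'I_n -> F) (e : 'I_n -> V) :
  skew_linear conj g -> g (\sum_i c i *: e i) = \sum_i conj (c i) * g (e i).
Proof.
move=> [gD gZ]; have g0 : g 0 = 0.
  by apply: (addrI (g 0)); rewrite -gD !addr0.
by rewrite (big_morph g gD g0); apply: eq_bigr.
Qed.

(** In finite dimension, injectivity of the operator attached to [b] on [X]
    already gives surjectivity: over a free generating family, the operator is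
    a square matrix with trivial kernel. *)
Lemma galerkin_unique_solution (X : set V) b g conj :
  (exists n (e : 'I_n -> V), X = spanned_by e) ->
  (forall v, skew_linear id (b^~ v)) -> (forall w, skew_linear conj (b w)) ->
  skew_linear conj g ->
  (forall w, X w -> (forall v, X v -> b w v = 0) -> w = 0) ->
  exists! U, X U /\ forall v, X v -> b U v = g v.
Proof.
move=> /spanned_by_free[n [e [Xe efree]]] bl br gl bdef.
have Xcomb (c : 'I_n -> F) : X (\sum_i c i *: e i) by rewrite Xe; exists c.
pose B : 'M[F]_n := \matrix_(i, j) b (e i) (e j).
have bB (c : 'rV[F]_n) j : b (\sum_i c 0 i *: e i) (e j) = (c *m B) 0 j.
  rewrite (skew_linear_sum _ _ (bl (e j))) mxE.
  by apply: eq_bigr => i _; rewrite mxE.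
have Bunit : B \in unitmx.
  rewrite -row_free_unit -kermx_eq0 -submx0; apply/row_subP => i.
  have: row i (kermx B) *m B = 0 by rewrite -row_mul mulmx_ker row0.
  move: (row i (kermx B)) => c cB0; rewrite submx0; apply/eqP/rowP => j.
  rewrite mxE; apply: (efree (c 0)); apply: bdef => // v; rewrite Xe => -[a _ <-].
  rewrite (skew_linear_sum _ _ (br _)) big1// => k _.
  by rewrite bB cB0 mxE mulr0.
pose c := (\row_j g (e j)) *m invmx B.
exists (\sum_i c 0 i *: e i); split; first split=> // v.
  rewrite Xe => -[a _ <-]; rewrite (skew_linear_sum _ _ (br _)).
  rewrite (skew_linear_sum _ _ gl); apply: eq_bigr => j _.
  by rewrite bB mulmxKV// mxE.
move=> W [XW bW]; apply/eqP; rewrite -subr_eq0; apply/eqP; apply: bdef.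
  move: XW; rewrite Xe => -[a _ <-]; exists (fun i => c 0 i - a i) => //.
  by rewrite -sumrB; apply: eq_bigr => i _; rewrite scalerBl.
move=> v Xv; have [bD bZ] := bl v.
rewrite bD -scaleN1r bZ mulN1r bW//; move: Xv; rewrite Xe => -[a _ <-].
rewrite (skew_linear_sum _ _ (br _)) (skew_linear_sum _ _ gl) -sumrB big1// => j _.
by rewrite bB mulmxKV// mxE subrr.
Qed.
End GalerkinLinearAlgebra.

Lemma conjs_skew_linear (R : realType) (P : problem R) :
  [/\ forall v : pb_H P, skew_linear id ((@pb_b R P)^~ v),
      forall w : pb_H P, skew_linear (@conjs R (pb_field P)) (pb_b w)
    & forall g, skew_linear (@conjs R (pb_field P)) (pb_pairing P g)].
Proof.
split=> [v|w|g]; split.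
- by move=> x y; rewrite /pb_b linearDl linearD linearDl addrACA.
- by move=> a x; rewrite /pb_b linearZl_LR linearZ linearZl_LR/= mulrDr.
- by move=> x y; rewrite /pb_b !linearD addrACA.
- by move=> a x; rewrite /pb_b !linearZr_LR/= mulrDr.
- by move=> x y; rewrite linearD.
- by move=> a x; rewrite linearZr_LR.
Qed.

(** A nonzero [w] in the kernel of [pb_b] on [X] makes the inner supremum zero. *)
Lemma infsup_definite (R : realType) (P : problem R) (X : set (pb_H P)) (g : R) :
  0 < g -> (g%:E <= infsup X)%E -> definite_on X.
Proof.
move=> g0 gX w Xw bw; apply/eqP/negP => /negP w0.
suff : (infsup X <= 0)%E.
  by move=> /(le_trans gX); rewrite lee_fin leNgt g0.
apply: ereal_inf_le; eexists; first by exists w => //; split=> //; apply/eqP.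
apply: ge_ereal_sup => _ [v [Xv _] <-].
by rewrite bw// /rnorm normr0; case: (pb_field P) => /=; rewrite mul0r.
Qed.

Lemma infsup_solvable (R : realType) (P : problem R) (X : set (pb_H P)) (g : R) :
  findim_subspace X -> 0 < g -> (g%:E <= infsup X)%E -> solvable X.
Proof.
move=> Xfin g0 /(infsup_definite g0) Xdef.
have [bl br gl] := conjs_skew_linear P.
exact: (galerkin_unique_solution Xfin bl br (gl _) Xdef).
Qed.

(** * Refinement of triangulations *)

Section Simplices.
Variables (R : realType) (d : nat).
Implicit Types (t u : element R d) (T : mesh R d).

Definition barycenter t : 'rV[R]_d := \sum_(p <- t) (#|` t|%:R)^-1 *: p.

Lemma sum_fset_const (K : choiceType) (A : {fset K}) (x : R) :
  \sum_(p <- A) x = x *+ #|` A|.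
Proof. by rewrite big_const_seq count_predT iter_addr_0 cardfE. Qed.

Lemma barycenter_body t : (0 < #|` t|)%N -> body t (barycenter t).
Proof.
move=> t0; exists (fun=> (#|` t|%:R)^-1); split=> //.
by rewrite sum_fset_const -[_^-1 *+ _]mulr_natr mulVf// pnatr_eq0 -lt0n.
Qed.

(** The barycentric coordinates of the barycenter are all positive, so that it
    lies in no proper face. *)
Lemma barycenter_face t u : (0 < #|` t|)%N -> affinely_independent t ->
  (u `<=` t)%fset -> body u (barycenter t) -> u = t.
Proof.
move=> t0 tind ut [c [c0 c1 xE]].
pose c' p := if p \in u then c p else 0.
have cu : \sum_(p <- t) c' p = 1.
  rewrite -c1 -(big_fset_incl _ ut) => [|p _ /negPf]; last by rewrite /c' => ->.
  by apply: eq_fbigr => p pu _; rewrite /c' pu.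
have xu : \sum_(p <- t) c' p *: p = barycenter t.
  rewrite xE -(big_fset_incl _ ut) => [|p _ /negPf pu]; last first.
    by rewrite /c' pu scale0r.
  by apply: eq_fbigr => p pu _; rewrite /c' pu.
apply/eqP; rewrite eqEfsubset ut; apply/fsubsetP => p pt.
have n0 : (#|` t|%:R : R) != 0 by rewrite pnatr_eq0 -lt0n.
have /eqP : c' p - (#|` t|%:R)^-1 = 0.
  apply: (tind (fun p => c' p - (#|` t|%:R)^-1)) => //.
    by rewrite sumrB cu sum_fset_const -[_^-1 *+ _]mulr_natr mulVf// subrr.
  rewrite -[RHS](subrr (barycenter t)) -{1}xu -sumrB; apply: eq_bigr => q _.
  by rewrite scalerBl.
by rewrite /c' subr_eq0; case: ifP => // _; rewrite eq_sym invr_eq0 (negPf n0).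
Qed.

(** Two elements meet in a common face, and no proper face of [t] contains its
    barycenter. *)
Lemma conforming_barycenter_inj (Omega : set 'rV[R]_d) T t u :
  conforming_triangulation Omega T -> t \in T -> u \in T ->
  body u (barycenter t) -> t = u.
Proof.
move=> [simp _ inter] tT uT xu.
have [ct tind] := simp _ tT; have [cu _] := simp _ uT.
have t0 : (0 < #|` t|)%N by rewrite ct.
have : body (t `&` u)%fset (barycenter t).
  by rewrite -inter//; split=> //; exact: barycenter_body.
move=> /(barycenter_face t0 tind (fsubsetIl _ _)) tuE.
by apply/eqP; rewrite eqEfcard cu ct leqnn andbT -tuE fsubsetIr.
Qed.

(** The barycenter of [t'] lies in the domain, hence in some [t] of the coarse
    mesh, hence in one of the elements of [T'] that subdivide [t]; by
    [conforming_barycenter_inj], this element is [t'] itself. *)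
Lemma subdivides_parent (Omega : set 'rV[R]_d) T T' t' :
  conforming_triangulation Omega T -> conforming_triangulation Omega T' ->
  subdivides T T' -> t' \in T' -> exists2 t, t \in T & body t' `<=` body t.
Proof.
move=> [_ cov _] T'conf sub t'T'; have [simp' cov' _] := T'conf.
have xt' : body t' (barycenter t').
  by apply: barycenter_body; have [-> _] := simp' _ t'T'.
have : closure Omega (barycenter t') by rewrite cov'; exists t'.
rewrite cov => -[t tT]; rewrite (sub _ tT) => -[u [uT' ut] xu].
by exists t => //; rewrite (conforming_barycenter_inj T'conf t'T' uT' xu).
Qed.

Lemma sons_unrefined (Omega : set 'rV[R]_d) T' t :
  conforming_triangulation Omega T' -> t \in T' ->
  (sons T' t `<=` [fset t])%fset.
Proof.
move=> T'conf tT'; apply/fsubsetP => t'; rewrite !inE/= => /andP[t'T' /asboolP t't].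
apply/eqP; apply: (conforming_barycenter_inj T'conf) => //.
have [simp' _ _] := T'conf; apply: t't; apply: barycenter_body.
by have [-> _] := simp' _ t'T'.
Qed.

Lemma card_bigfcup (I K : choiceType) (r : seq I) (F : I -> {fset K}) :
  (#|` \bigcup_(i <- r) F i| <= \sum_(i <- r) #|` F i|)%fset%N.
Proof.
elim: r => [|i r IH]; first by rewrite !big_nil cardfs0.
by rewrite !big_cons (leq_trans (leq_card_fsetU _ _))// leq_add2l.
Qed.

End Simplices.

Section RefinementCounting.
Variables (R : realType) (d : nat) (S : refinement_setting R d).
Local Notation refine := (rg_refine S).
Local Notation T0 := (rg_T0 S).
Implicit Types T M : mesh R d.

Lemma refines_trans T1 T2 T3 :
  refines refine T1 T2 -> refines refine T2 T3 -> refines refine T1 T3.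
Proof. by move=> T12; elim=> // T M _ T1T MT; exact: refines_step. Qed.

Lemma refines_uniform m T : refines refine T (uniform_refine refine m T).
Proof.
elim: m => [|m IH]; first exact: refines_refl.
by rewrite /uniform_refine iterS; apply: refines_step.
Qed.

Lemma refines_conforming T :
  refines refine T0 T -> conforming_triangulation (rg_Omega S) T.
Proof.
case=> [|T' M T'T0 MT']; first exact: rg_T0P.
by have [] := rg_refineP T'T0 MT'.
Qed.

Lemma card_refines T T' : refines refine T0 T -> refines refine T T' ->
  (#|` T| <= #|` T'|)%N.
Proof.
by move=> TT0 T'T; apply: leq_trans (rg_sons_card TT0 T'T); rewrite leq_addl.
Qed.

Lemma card_refine_ge T M : refines refine T0 T -> (M `<=` T)%fset ->
  (#|` M| + #|` T| <= #|` refine T M|)%N.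
Proof.
move=> TT0 MT; have [_ _ /fsubset_leq_card cM _] := rg_refineP TT0 MT.
apply: leq_trans (rg_sons_card TT0 (refines_step (refines_refl _ _) MT)).
by rewrite leq_add2r.
Qed.

(** Every element of the refined mesh is a son of some element of [T], and an
    element that survives is its own only son. *)
Lemma card_refine_le T M : refines refine T0 T -> (M `<=` T)%fset ->
  (#|` refine T M| <= maxn (rg_Cson S) 1 * #|` T|)%N.
Proof.
move=> TT0 MT; set T' := refine T M.
have T'conf : conforming_triangulation (rg_Omega S) T'.
  exact/refines_conforming/refines_step.
have [_ sub _ _] := rg_refineP TT0 MT.
have T'sons : (T' `<=` \bigcup_(t <- T) sons T' t)%fset.
  apply/fsubsetP => t' t'T'.
  have [t tT t't] := subdivides_parent (refines_conforming TT0) T'conf sub t'T'.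
  by apply/bigfcupP; exists t; rewrite ?tT// !inE/= t'T'; apply/asboolP.
apply: (leq_trans (fsubset_leq_card T'sons)); apply: (leq_trans (card_bigfcup _ _)).
rewrite mulnC -sum1_size big_distrl/= big_seq [leqRHS]big_seq.
apply: leq_sum => t tT; rewrite mul1n.
have [tT'|tT'] := boolP (t \in T').
  rewrite (leq_trans (fsubset_leq_card (sons_unrefined T'conf tT')))//.
  by rewrite cardfs1 leq_maxr.
have /(rg_sons TT0 MT)/andP[_ /leq_trans->//] : t \in (T `\` T')%fset.
  by rewrite inE tT' tT.
by rewrite leq_maxl.
Qed.

End RefinementCounting.

(** * Powers and geometric sums *)

Section PowerLemmas.
Variable R : realType.
Implicit Types (s p q x y C : R).

Lemma powR_invK s x : s != 0 -> 0 <= x -> (x `^ s^-1) `^ s = x.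
Proof. by move=> s0 x0; rewrite -powRrM mulVf// powRr1. Qed.

Lemma le_powR s x y : 0 <= s -> 0 <= x -> x <= y -> x `^ s <= y `^ s.
Proof.
by move=> s0 x0 xy; apply: ge0_ler_powR; rewrite ?nnegrE// (le_trans x0).
Qed.

(** Solves [x <= C * y `^ (- s^-1)] for [y]. *)
Lemma ler_of_powRNinv s C x y : 0 < s -> 0 <= C -> 0 < x -> 0 < y ->
  x <= C * y `^ (- s^-1) -> y <= C `^ s * x `^ (- s).
Proof.
move=> s0 C0 x0 y0 /(le_powR (ltW s0) (ltW x0)).
rewrite powRM ?powR_ge0// -powRrM mulNr mulVf ?gt_eqF// powR_inv1 ?(ltW y0)//.
by rewrite powRN !ler_pdivlMr ?powR_gt0// mulrC.
Qed.

Lemma geometric_sum_rev q k : (1 - q) * \sum_(i < k) q ^+ (k - i) = q - q ^+ k.+1.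
Proof.
elim: k => [|k IH]; first by rewrite big_ord0 mulr0 expr1 subrr.
by rewrite big_ord_recl/= subn0 mulrDr IH; rewrite !exprS; ring.
Qed.

(** Under linear convergence, the powers [e i `^ (- p)] grow at least
    geometrically, so that the last term controls the sum of all of them. *)
Lemma linear_convergence_sum p q C (e : nat -> R) k :
  0 < p -> 0 < q < 1 -> 0 < C -> 0 < e k ->
  (forall i, (i < k)%N -> e k <= C * q ^+ (k - i) * e i) ->
  \sum_(i < k) e i `^ (- p) <= C `^ p / (1 - q `^ p) * e k `^ (- p).
Proof.
move=> p0 /andP[q0 q1] C0 ek0 lin; set Q := q `^ p.
have Q1 : Q < 1.
  have := @gt0_ltr_powR _ _ p0 q 1; rewrite powR1; apply; rewrite ?nnegrE//.
  exact: ltW.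
have term (i : 'I_k) : e i `^ (- p) <= C `^ p * e k `^ (- p) * Q ^+ (k - i).
  have Cq0 : 0 < C * q ^+ (k - i) by rewrite mulr_gt0// exprn_gt0.
  have ei0 : 0 < e i by rewrite -(pmulr_rgt0 _ Cq0) (lt_le_trans ek0)// lin.
  rewrite !powRN mulrAC ler_pdivlMr ?powR_gt0// ler_pdivrMl ?powR_gt0//.
  rewrite mulrC -powR_mulrn ?powR_ge0// -powRrM [p * _]mulrC powRrM.
  rewrite powR_mulrn ?(ltW q0)// -!powRM ?(ltW C0, ltW ei0, exprn_ge0, ltW q0)//.
    by apply: (le_powR (ltW p0) (ltW ek0)); exact: lin.
  by rewrite mulr_ge0 ?(ltW C0)// exprn_ge0 ?(ltW q0).
apply: (le_trans (ler_sum _ (fun i _ => term i))); rewrite -mulr_sumr.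
rewrite [leRHS]mulrAC ler_pM2l; last by rewrite mulr_gt0 ?powR_gt0.
rewrite -[leRHS]mul1r ler_pdivlMr ?subr_gt0// mulrC geometric_sum_rev.
by rewrite lerBlDr (le_trans (ltW Q1))// lerDl exprn_ge0// powR_ge0.
Qed.

End PowerLemmas.

(** * Optimality of the marking criterion *)

(** The number [kappa] is the root of [theta + (x + y * sqrt theta) ^+ 2 = 1]:
    a drop of the estimator below the fraction [kappa] is incompatible with
    [r ^+ 2 < theta * E ^+ 2]. *)
Definition kappa (R : realType) (theta y : R) : R :=
  Num.sqrt (1 - theta) - y * Num.sqrt theta.

Lemma kappa_gt0 (R : realType) (theta y : R) :
  0 <= y -> 0 < theta < (1 + y ^+ 2)^-1 -> 0 < kappa theta y.
Proof.
move=> y0 /andP[t0]; have y2 : 0 < 1 + y ^+ 2 by rewrite ltr_pwDl// sqr_ge0.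
rewrite -[_^-1]mul1r ltr_pdivlMr// => ty.
rewrite /kappa subr_gt0 -{1}(ger0_norm y0) -sqrtr_sqr -sqrtrM ?sqr_ge0//.
rewrite ltr_sqrt//; first nra.
have := sqr_ge0 y; nra.
Qed.

Lemma kappa_marking (R : realType) (theta y E r B : R) :
  0 < theta < 1 -> 0 <= y -> 0 <= E -> 0 <= r -> 0 <= B -> 0 <= kappa theta y ->
  E ^+ 2 <= r ^+ 2 + B ^+ 2 -> B <= kappa theta y * E + y * r ->
  theta * E ^+ 2 <= r ^+ 2.
Proof.
move=> /andP[t0 t1] y0 E0 r0 B0 k0 EB Br; rewrite leNgt; apply/negP => rE.
have rE' : r < Num.sqrt theta * E.
  rewrite -(ltr_pXn2r (_ : 0 < 2)%N) ?nnegrE ?mulr_ge0 ?sqrtr_ge0//.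
  by rewrite exprMn sqr_sqrtr ?(ltW t0).
have BE : B <= Num.sqrt (1 - theta) * E.
  by move: (ler_wpM2l y0 (ltW rE')) Br; rewrite /kappa; nra.
have : B ^+ 2 <= (1 - theta) * E ^+ 2.
  rewrite -[1 - theta]sqr_sqrtr ?subr_ge0 ?(ltW t1)// -exprMn.
  by rewrite ler_pXn2r ?nnegrE ?mulr_ge0 ?sqrtr_ge0.
by nra.
Qed.

Section EstimatorSums.
Variables (R : realType) (d : nat) (S : refinement_setting R d) (P : problem R).
Variable D : discretization S P.
Implicit Types T A B : mesh R d.

Lemma sqr_eta_on T A : eta_on D T A ^+ 2 = \sum_(t <- A) ds_eta D T t ^+ 2.
Proof. by rewrite sqr_sqrtr// sumr_ge0// => t _; exact: sqr_ge0. Qed.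

Lemma sqr_eta_onID T A B :
  eta_on D T A ^+ 2 = eta_on D T (A `&` B)%fset ^+ 2 + eta_on D T (A `\` B)%fset ^+ 2.
Proof.
rewrite !sqr_eta_on (big_fsetID _ (mem B))/=; by congr (_ + _); apply: eq_fbigl => t; rewrite !inE//= andbC.
Qed.

Lemma eta_on_mono T A B : (A `<=` B)%fset -> eta_on D T A <= eta_on D T B.
Proof.
move=> AB; rewrite -(ler_pXn2r (_ : 0 < 2)%N) ?nnegrE ?sqrtr_ge0//.
by rewrite (sqr_eta_onID T B A) (fsetIidPr AB) lerDl sqr_ge0.
Qed.

End EstimatorSums.

Section OptimalMarking.
Variables (R : realType) (d : nat) (S : refinement_setting R d) (P : problem R).
Variables (D : discretization S P) (Cstb Crel gamma0 Cmon theta : R) (m : nat).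
Hypotheses (Cstb_gt0 : 0 < Cstb) (Crel_gt0 : 0 < Crel) (gamma0_gt0 : 0 < gamma0)
  (Cmon_gt0 : 0 < Cmon)
  (theta_opt : 0 < theta < (1 + Cstb ^+ 2 * Crel ^+ 2 / gamma0 ^+ 2)^-1)
  (Dstb : stability D Cstb) (Drel : discrete_reliability D Crel)
  (Dhat : hat_mesh_properties D m gamma0 Cmon).
Local Notation refine := (rg_refine S).
Local Notation T0 := (rg_T0 S).
Local Notation hat := (hatT0 S m).
Local Notation kap := (kappa theta (Cstb * Crel / gamma0)).
Implicit Types T : mesh R d.

Lemma refines_T0 T : refines refine hat T -> refines refine T0 T.
Proof. exact/refines_trans/refines_uniform. Qed.

Lemma hat_has_sol T : refines refine hat T -> has_sol D T.
Proof.
move=> hatT; have [inf_hat _ _] := Dhat.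
exact: (infsup_solvable (ds_findim _ (refines_T0 hatT)) gamma0_gt0 (inf_hat _ hatT)).
Qed.

(** The inverse of the inf-sup constant is taken in the extended reals; on meshes
    finer than [hat] it is at most [gamma0^-1], also when the discrete space is
    trivial and the inf-sup constant infinite. *)
Lemma galerkin_diff_le T T' : refines refine T0 T -> refines refine T T' ->
  has_sol D T -> refines refine hat T' ->
  exists2 Rf : mesh R d, (Rf `<=` T)%fset &
    [/\ normH (sol D T' - sol D T) <= Crel / gamma0 * eta_on D T Rf,
        (T `\` T' `<=` Rf)%fset
      & #|` Rf|%:R <= Crel * #|` (T `\` T')%fset|%:R].
Proof.
move=> TT0 T'T solT hatT'; have [inf_hat _ _] := Dhat.
have [Rf RfT /(_ solT (hat_has_sol hatT'))[le_inf sub card]] := Drel TT0 T'T.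
exists Rf => //; split=> //; rewrite -lee_fin; apply: (le_trans le_inf).
rewrite EFinM; apply: lee_wpmul2r; first by rewrite lee_fin sqrtr_ge0.
rewrite EFinM; apply: lee_wpmul2l; first by rewrite lee_fin ltW.
have -> : (gamma0^-1%:E = gamma0%:E^-1)%E by rewrite inver gt_eqF.
have inf_ge := inf_hat _ hatT'.
by rewrite lee_pV2// inE/= ?lee_fin ?(ltW gamma0_gt0)// (le_trans _ inf_ge)// lee_fin ltW.
Qed.

Let theta01 : 0 < theta < 1.
Proof.
have c0 : 0 <= Cstb ^+ 2 * Crel ^+ 2 / gamma0 ^+ 2.
  by rewrite -exprMn -expr_div_n sqr_ge0.
case/andP: theta_opt => -> /lt_le_trans->//.
by rewrite invf_le1 ?lerDl// ltr_pwDl.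
Qed.

Lemma kappa_opt_gt0 : 0 < kap.
Proof.
apply: kappa_gt0; first by rewrite divr_ge0 ?mulr_ge0 ?ltW.
by rewrite expr_div_n exprMn.
Qed.

(** Stability moves the estimator contributions on the common elements from
    the fine to the coarse mesh, and discrete reliability bounds the price of
    this move by the contributions of [Rf]. *)
Lemma doerfler_of_drop T T' : refines refine T0 T -> refines refine T T' ->
  has_sol D T -> refines refine hat T' -> est D T' <= kap * est D T ->
  exists2 Rf : mesh R d, doerfler D theta T Rf &
    #|` Rf|%:R <= Crel * #|` (T `\` T')%fset|%:R.
Proof.
move=> TT0 T'T solT hatT' drop.
have [Rf RfT [le_diff sub card]] := galerkin_diff_le TT0 T'T solT hatT'.
exists Rf => //; split=> //.
have y0 : 0 <= Cstb * Crel / gamma0 by rewrite divr_ge0 ?mulr_ge0 ?ltW.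
apply: (kappa_marking (B := eta_on D T (T `&` T')%fset) theta01 y0);
  rewrite ?sqrtr_ge0 ?(ltW kappa_opt_gt0)//.
  rewrite /est (sqr_eta_onID D T T T') addrC lerD2r.
  by rewrite ler_pXn2r ?nnegrE ?sqrtr_ge0// eta_on_mono.
have stb := Dstb TT0 T'T solT (hat_has_sol hatT').
rewrite fsetIC.
have common : eta_on D T' (T' `&` T)%fset <= kap * est D T.
  by apply: le_trans drop; apply: eta_on_mono; exact: fsubsetIl.
have := ler_wpM2l (ltW Cstb_gt0) le_diff.
move: stb; rewrite distrC => /(le_trans (ler_norm _)).
rewrite !mulrA; lra.
Qed.

Section ApproximationClass.
Variable s : R.
Hypotheses (s_gt0 : 0 < s) (u_As : (approx_norm D s < +oo)%E).
Local Notation A := (fine (approx_norm D s)).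

Lemma est_ge0 T : 0 <= est D T. Proof. exact: sqrtr_ge0. Qed.

Lemma min_est_ge0 N : 0 <= min_est D N.
Proof.
rewrite /min_est; case: ifPn => // /asboolPn/eqP/set0P[T TN].
by apply: lb_le_inf => [|_ [T' _ <-]]; [exists (est D T); exists T|exact: est_ge0].
Qed.

Lemma min_est_le N T : meshes_upto D N T -> min_est D N <= est D T.
Proof.
move=> TN; rewrite /min_est ifF.
  apply: ge_inf; last by exists T.
  by exists 0 => x [T' _ <-]; exact: est_ge0.
by apply/asboolP => TN0; move: TN; rewrite TN0.
Qed.

Lemma min_est_lt N T x : meshes_upto D N T -> min_est D N < x ->
  exists2 T', meshes_upto D N T' & est D T' < x.
Proof.
move=> TN; rewrite /min_est ifF; last first.
  by apply/asboolP => TN0; move: TN; rewrite TN0.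
by case/inf_lt => [|_ [T' T'N <-]]; [exists (est D T); exists T|exists T'].
Qed.

Lemma min_est_le_approx_norm N : N.+1%:R `^ s * min_est D N <= A.
Proof.
have ub : ((N.+1%:R `^ s * min_est D N)%:E <= approx_norm D s)%E.
  by apply: ereal_sup_ubound; exists N.
by rewrite -lee_fin fineK// fin_numElt u_As (lt_le_trans _ ub)// ltNyr.
Qed.

Lemma approx_norm_ge0 : 0 <= A.
Proof.
by apply: le_trans (min_est_le_approx_norm 0); rewrite mulr_ge0 ?powR_ge0 ?min_est_ge0.
Qed.

(** The convention that the minimum over an empty class of meshes is zero
    carries no information on meshes, so that the complexity has to exceed
    that of the solvable mesh [hat]. *)
Lemma near_optimal_mesh x : 0 < x ->
  exists T, [/\ refines refine T0 T, has_sol D T, est D T < 2 * x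
    & #|` T|%:R <= #|` T0|%:R + #|` hat|%:R + (A / x) `^ s^-1].
Proof.
move=> x0; have Ax0 : 0 <= A / x by rewrite divr_ge0 ?approx_norm_ge0 ?ltW.
set z := (A / x) `^ s^-1; have z0 : 0 <= z by exact: powR_ge0.
(* The summand [z] makes [A / N.+1%:R `^ s <= x], and the first one puts [hat] into
   the class of meshes of complexity [N]. *)
pose N := (#|` hat| + Num.trunc z)%N.
have hatN : meshes_upto D N hat.
  split; [exact: refines_uniform| |exact/hat_has_sol/refines_refl].
  rewrite natrD; have := ler0n R (Num.trunc z); have := ler0n R #|` T0|; lra.
have zN : z <= N.+1%:R.
  by rewrite (le_trans (ltW (truncnS_gt _)))// ler_nat ltnS leq_addl.
have minx : min_est D N < 2 * x.
  apply: (@le_lt_trans _ _ x); last by rewrite ltr_pMl// ltr1n.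
  rewrite -(ler_pM2l (powR_gt0 s (ltr0Sn R N))).
  apply: (le_trans (min_est_le_approx_norm N)).
  rewrite -ler_pdivrMr// -[leLHS](powR_invK (s := s)) ?gt_eqF//.
  by apply: le_powR => //; exact: ltW.
have [T [TT0 cardT solT] estT] := min_est_lt hatN minx.
exists T; split=> //; move: cardT; rewrite natrD.
have /andP[] := truncn_itv z0; lra.
Qed.

(** The near-optimal mesh is first refined uniformly, which costs a bounded
    factor of elements and makes its estimator quasi-monotone, and then
    overlaid with [T]. *)
Lemma marking_card_le T : refines refine hat T -> 0 < est D T ->
  exists2 Rf : mesh R d, doerfler D theta T Rf &
    #|` Rf|%:R <= Crel * (rg_Cson S ^ m)%:R *
      (#|` T0|%:R + #|` hat|%:R
       + (A / (kap / (2 * Cmon) * est D T)) `^ s^-1).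
Proof.
move=> hatT estT; have [_ mon unif] := Dhat.
have [|Te [TeT0 solTe estTe cardTe]] := @near_optimal_mesh (kap / (2 * Cmon) * est D T).
  by rewrite mulr_gt0// divr_gt0 ?kappa_opt_gt0// mulr_gt0.
have [hatTe cardhatTe] := unif _ TeT0.
have [T' [TeT' TT' cardT']] := rg_overlay (refines_uniform S m T0) hatTe hatT.
have hatT' : refines refine hat T' by exact: refines_trans hatTe TeT'.
have drop : est D T' <= kap * est D T.
  apply: le_trans (mon Te T' TeT0 solTe hatT' _) _.
    exact: refines_trans (refines_uniform S m Te) TeT'.
  rewrite -ler_pdivlMl// (le_trans (ltW estTe))// le_eqVlt; apply/orP; left.
  apply/eqP; field; rewrite ?gt_eqF//.
have [Rf RfD cardRf] :=
  doerfler_of_drop (refines_T0 hatT) TT' (hat_has_sol hatT) hatT' drop.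
exists Rf => //; apply: (le_trans cardRf); rewrite -mulrA ler_pM2l//.
apply: le_trans (ler_wpM2l (ler0n R _) cardTe).
rewrite -natrM ler_nat; apply: leq_trans cardhatTe.
rewrite -(leq_add2r #|` T|) (leq_trans (rg_sons_card (refines_T0 hatT) TT'))//.
by apply: leq_trans cardT'; exact: leq_addr.
Qed.

End ApproximationClass.
End OptimalMarking.

(** * The adaptive sequence *)

Section AdaptiveRun.
Variables (R : realType) (d : nat) (S : refinement_setting R d) (P : problem R).
Variables (D : discretization S P) (theta Cmark : R).
Variables (T M : nat -> mesh R d) (U : nat -> pb_H P) (eta : nat -> R).
Hypothesis run : adaptive_run D theta Cmark T M U eta.
Local Notation refine := (rg_refine S).
Local Notation T0 := (rg_T0 S).

Lemma run_step l : (M l `<=` T l)%fset /\ T l.+1 = refine (T l) (M l).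
Proof.
have [_ /(_ l)[solved unsolved ->]] := run; split=> //.
have [/solved[_ _ [] //]|/unsolved[_ _ ->]] := pselect (has_sol D (T l)).
exact: fsubset_refl.
Qed.

Lemma run_refines l : refines refine T0 (T l).
Proof.
elim: l => [|l IH]; first by have [-> _] := run; exact: refines_refl.
by have [Ml ->] := run_step l; exact: refines_step.
Qed.

Lemma run_card_ge l : (#|` T0| <= #|` T l|)%N.
Proof. exact: card_refines (refines_refl _ _) (run_refines l). Qed.

Lemma run_card_step l : (#|` M l| + #|` T l| <= #|` T l.+1|)%N.
Proof.
by have [Ml ->] := run_step l; exact: card_refine_ge (run_refines l) Ml.
Qed.

Lemma run_sum_marked l : (\sum_(j < l) #|` M j| + #|` T0| <= #|` T l|)%N.
Proof.
elim: l => [|l IH]; first by rewrite big_ord0 run_card_ge.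
apply: leq_trans (run_card_step l); rewrite big_ord_recr/=.
by rewrite [(_ + #|` M l|)%N]addnC -addnA leq_add2l.
Qed.

Lemma run_est l : has_sol D (T l) -> eta l = est D (T l).
Proof. by have [_ /(_ l)[solved _ _]] := run => /solved[]. Qed.

(** Unless the estimator vanishes, the marked sets are nonempty, so that the
    number of elements eventually exceeds any bound. *)
Lemma run_crossing l0 N : (#|` T l0| <= N)%N ->
  exists2 l, (l0 <= l)%N &
    (#|` T l| <= N)%N /\ (M l = fset0 \/ (N < #|` T l.+1|)%N).
Proof.
move=> TN; apply: contrapT => nocross.
have step k : (#|` T (l0 + k)%N| <= N)%N /\ (k <= #|` T (l0 + k)%N|)%N.
  elim: k => [|k [IHN IHk]]; first by rewrite addn0.
  have : ~ (M (l0 + k)%N = fset0 \/ (N < #|` T (l0 + k).+1|)%N).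
    by move=> cross; apply: nocross; exists (l0 + k)%N => //; exact: leq_addr.
  move=> /not_orP[/eqP Mk /negP]; rewrite -leqNgt addnS => Tk.
  split=> //; apply: leq_trans (run_card_step _).
  by rewrite -add1n leq_add// cardfs_gt0.
have [TN1 NT] := step N.+1.
by have := leq_trans NT TN1; rewrite ltnn.
Qed.

(** For [N] beyond the complexity of [T l0], [run_crossing] provides an adaptive
    mesh in the class of complexity [N] whose own complexity is smaller than
    [N] by at most a constant factor, or whose estimator is zero.  The remaining
    finitely many [N] only contribute a finite sum. *)
Lemma approx_norm_lt_pinfty s C l0 : 0 < theta -> 0 < s -> 0 < C ->
  (forall l, (l0 <= l)%N -> has_sol D (T l)) ->
  (forall l, (l0 <= l)%N ->
     eta l <= C * (#|` T l|%:R - #|` T0|%:R + 1) `^ (- s)) ->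
  (approx_norm D s < +oo)%E.
Proof.
move=> theta0 s0 C0 solT rate.
pose K := (maxn (rg_Cson S) 1 * #|` T0|.+1)%N.
have tail N : (#|` T l0| <= N + #|` T0|)%N ->
    N.+1%:R `^ s * min_est D N <= K%:R `^ s * C.
  move=> /run_crossing[l l0l [TlN cross]].
  have TlN' : meshes_upto D N (T l).
    split; [exact: run_refines| |exact: solT].
    by rewrite lerBlDr -natrD ler_nat.
  apply: (le_trans (ler_wpM2l (powR_ge0 _ _) (min_est_le TlN'))).
  case: cross => [Ml0|NTl].
    have [_ /(_ l)[/(_ (solT _ l0l))[_ _ [_ mark] _] _ _]] := run.
    (* An empty marked set satisfies the marking criterion only if [est D (T l) = 0]. *)
    have /eqP -> : est D (T l) == 0.
      have := mark; rewrite Ml0 sqr_eta_on big_seq_fset0 pmulr_rle0// => est0.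
      by rewrite -sqrf_eq0 eq_le est0 sqr_ge0.
    by rewrite mulr0 mulr_ge0 ?powR_ge0 ?ltW.
  rewrite -(run_est (solT _ l0l)).
  apply: (le_trans (ler_wpM2l (powR_ge0 _ _) (rate _ l0l))).
  set X := _ - _ + 1; have XE : X = (#|` T l| - #|` T0|).+1%:R.
    by rewrite /X -natrB ?run_card_ge// -natr1.
  have X0 : 0 < X by rewrite XE ltr0n.
  rewrite mulrCA [leRHS]mulrC ler_pM2l// powRN ler_pdivrMr ?powR_gt0//.
  rewrite -powRM ?(ltW X0)//; apply: le_powR => //; first exact: ltW.
  have [Ml TS] := run_step l.
  rewrite XE -natrM ler_nat.
  have := card_refine_le (run_refines l) Ml; rewrite -TS => cTS.
  have : (N.+1 <= maxn (rg_Cson S) 1 * #|` T l|)%N.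
    by apply: leq_trans cTS; apply: leq_trans NTl; rewrite ltnS leq_addr.
  move=> /leq_trans; apply; rewrite /K -mulnA leq_mul2l; apply/orP; right.
  have := run_card_ge l; nia.
pose B := K%:R `^ s * C + \sum_(N < #|` T l0|) N.+1%:R `^ s * min_est D N.
have term_ge0 N : 0 <= N.+1%:R `^ s * min_est D N.
  by rewrite mulr_ge0 ?powR_ge0 ?min_est_ge0.
apply: (@le_lt_trans _ _ B%:E); last by rewrite ltry.
apply: ge_ereal_sup => _ [N _ <-]; rewrite lee_fin /B.
have [lowN|] := ltnP N #|` T l0|.
  rewrite -[leLHS]add0r lerD ?mulr_ge0 ?powR_ge0 ?(ltW C0)//.
  by rewrite (bigD1 (Ordinal lowN))//= lerDl sumr_ge0.
move=> highN; rewrite -[leLHS]addr0 lerD ?sumr_ge0// tail//.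
by rewrite (leq_trans highN)// leq_addr.
Qed.

End AdaptiveRun.

(** * Quasi-optimal convergence rates *)

Section OptimalRate.
Variables (R : realType) (d : nat) (S : refinement_setting R d).
Variables (Cstb Crel gamma0 Cmon Clin qlin Cmark theta s : R) (m : nat).
Local Notation T0 := (rg_T0 S).
Local Notation refine := (rg_refine S).
Local Notation hat := (hatT0 S m).
Local Notation kap := (kappa theta (Cstb * Crel / gamma0)).

(** The factor in [#|` M l| <= marking_const A e * eta l `^ (- s^-1)], where
    [A] bounds the approximation norm and [Cmon * e] bounds [eta l]. *)
Definition marking_const (A e : R) : R :=
  Cmark * (Crel * (rg_Cson S ^ m)%:R *
    ((#|` T0|%:R + #|` hat|%:R) * (Cmon * e) `^ s^-1
     + (A / (kap / (2 * Cmon))) `^ s^-1)).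

(** The two summands after [1] account for the at most [n] elements created before
    linear convergence sets in and for those created afterwards; the [1] makes the
    constant positive for all arguments. *)
Definition rate_const (n : nat) (A e : R) : R :=
  (1 + (1 + rg_Cmesh S * n%:R) * (Cmon * e) `^ s^-1
   + rg_Cmesh S * marking_const A e * (Clin `^ s^-1 / (1 - qlin `^ s^-1))) `^ s.

Hypotheses (Cstb_gt0 : 0 < Cstb) (Crel_gt0 : 0 < Crel) (gamma0_gt0 : 0 < gamma0)
  (Cmon_gt0 : 0 < Cmon) (Clin_gt0 : 0 < Clin) (qlin01 : 0 < qlin < 1)
  (Cmark_ge1 : 1 <= Cmark)
  (theta_opt : 0 < theta < (1 + Cstb ^+ 2 * Crel ^+ 2 / gamma0 ^+ 2)^-1)
  (s_gt0 : 0 < s).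

Let Cmark_ge0 : 0 <= Cmark. Proof. exact: le_trans Cmark_ge1. Qed.
Let Cmesh_ge0 : 0 <= rg_Cmesh S. Proof. exact: le_trans (rg_Cmesh1 S). Qed.
Let p_gt0 : 0 < s^-1. Proof. by rewrite invr_gt0. Qed.

Lemma marking_const_ge0 A e : 0 <= marking_const A e.
Proof.
rewrite mulr_ge0// mulr_ge0 ?addr_ge0 ?powR_ge0//; first by rewrite mulr_ge0// ltW.
by rewrite mulr_ge0 ?powR_ge0// addr_ge0.
Qed.

Lemma lin_factor_ge0 : 0 <= Clin `^ s^-1 / (1 - qlin `^ s^-1).
Proof.
case/andP: qlin01 => q0 q1; rewrite divr_ge0 ?powR_ge0// subr_ge0.
by have := le_powR (ltW p_gt0) (ltW q0) (ltW q1); rewrite powR1.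
Qed.

Lemma rate_const_gt0 n A e : 0 < rate_const n A e.
Proof.
apply: powR_gt0; rewrite -addrA ltr_pwDl// addr_ge0//.
  by rewrite mulr_ge0 ?powR_ge0// addr_ge0// mulr_ge0.
by rewrite mulr_ge0 ?lin_factor_ge0// mulr_ge0// marking_const_ge0.
Qed.

Variables (P : problem R) (D : discretization S P).
Hypotheses (Dstb : stability D Cstb) (Drel : discrete_reliability D Crel)
  (Dhat : hat_mesh_properties D m gamma0 Cmon).
Variables (T M : nat -> mesh R d) (U : nat -> pb_H P) (eta : nat -> R).
Hypothesis run : adaptive_run D theta Cmark T M U eta.
Hypothesis u_As : (approx_norm D s < +oo)%E.
Local Notation A := (fine (approx_norm D s)).

Lemma run_card_marked l : refines refine hat (T l) -> 0 < eta l ->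
  #|` M l|%:R <= marking_const A (est D hat) * eta l `^ (- s^-1).
Proof.
move=> hatT eta0; have solT := hat_has_sol gamma0_gt0 Dhat hatT.
have etaE := run_est run solT.
have [_ /(_ l)[/(_ solT)[_ _ _ minM] _ _]] := run.
have eta0' := eta0; rewrite etaE in eta0'.
have [Rf /minM leM cardRf] :=
  marking_card_le Cstb_gt0 Crel_gt0 gamma0_gt0 Cmon_gt0 theta_opt Dstb Drel Dhat
    s_gt0 u_As hatT eta0'.
apply: (le_trans leM); rewrite /marking_const -mulrA ler_wpM2l//.
apply: (le_trans cardRf); rewrite -etaE -[leRHS]mulrA ler_wpM2l//.
  by rewrite mulr_ge0// ltW.
have k0 : 0 < kap by exact: kappa_opt_gt0.
have A0 : 0 <= A by exact: approx_norm_ge0.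
have lam0 : 0 < kap / (2 * Cmon) by rewrite divr_gt0// mulr_gt0.
rewrite [leRHS]mulrDl; apply: lerD.
  rewrite -mulrA ler_peMr ?addr_ge0// powRN ler_pdivlMr ?powR_gt0// mul1r.
  apply: le_powR; rewrite ?(ltW p_gt0) ?(ltW eta0)// etaE.
  have [_ mon _] := Dhat; apply: mon => //; first exact: refines_uniform.
  exact: (hat_has_sol gamma0_gt0 Dhat (refines_refl _ _)).
have Al0 : 0 <= A / (kap / (2 * Cmon)) by apply: divr_ge0 => //; exact: ltW.
rewrite invfM mulrA powRM ?Al0 ?invr_ge0 ?(ltW eta0)//.
by rewrite -[(eta l)^-1]powR_inv1 ?(ltW eta0)// -powRrM mulN1r.
Qed.

(** The closure estimate turns the bound on the marked elements into a sum of
    powers of the estimators, which linear convergence bounds by its last term.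
    The elements created before the index [l0] only contribute a constant, and
    [eta l <= Cmon * est D hat] absorbs it. *)
Lemma run_rate l0 : (forall l, (l0 <= l)%N -> refines refine hat (T l)) ->
  (forall l n, (l0 <= l)%N -> eta (l + n)%N <= Clin * qlin ^+ n * eta l) ->
  forall l, (l0 <= l)%N ->
  eta l <= rate_const #|` T l0| A (est D hat) * (#|` T l|%:R - #|` T0|%:R + 1) `^ (- s).
Proof.
move=> hatT lin l l0l.
have etaE j (lj : (l0 <= j)%N) : eta j = est D (T j).
  exact/(run_est run)/(hat_has_sol gamma0_gt0 Dhat)/hatT.
(* Negative powers of [eta l] are only meaningful for [0 < eta l]. *)
have [eta_le0|eta_gt0] := leP (eta l) 0.
  apply: (le_trans eta_le0); rewrite mulr_ge0 ?powR_ge0//.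
have [k lE] : exists k, l = (l0 + k)%N by exists (l - l0)%N; rewrite subnKC.
have lin' i : (i < k)%N -> eta (l0 + k)%N <= Clin * qlin ^+ (k - i) * eta (l0 + i)%N.
  move=> ik; have := lin (l0 + i)%N (k - i)%N (leq_addr _ _).
  by rewrite -addnA subnKC// ltnW.
rewrite lE in eta_gt0 *.
have eta_i i : (i < k)%N -> 0 < eta (l0 + i)%N.
  move=> ik; have := lt_le_trans eta_gt0 (lin' i ik); rewrite pmulr_rgt0//.
  by rewrite mulr_gt0// exprn_gt0//; case/andP: qlin01.
apply: ler_of_powRNinv => //.
- rewrite -addrA addr_ge0// addr_ge0//.
    by rewrite mulr_ge0 ?powR_ge0// addr_ge0// mulr_ge0.
  by rewrite mulr_ge0 ?lin_factor_ge0// mulr_ge0// marking_const_ge0.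
- by rewrite ltr_wpDl// subr_ge0 ler_nat (run_card_ge run).
have [T0E _] := run; have steps := run_step run.
have := rg_closure T0E steps (l0 + k)%N.
rewrite big_split_ord/= => closure_est.
set K3 := marking_const A (est D hat) in closure_est *.
(* This absorbs the constant contributions into powers of the estimator. *)
have b1 : 1 <= (Cmon * est D hat) `^ s^-1 * eta (l0 + k)%N `^ (- s^-1).
  rewrite powRN ler_pdivlMr ?powR_gt0// mul1r.
  apply: le_powR; rewrite ?(ltW p_gt0) ?(ltW eta_gt0)// etaE ?leq_addr//.
  have [_ mon _] := Dhat; apply: mon => //.
  - exact: refines_uniform.
  - exact: (hat_has_sol gamma0_gt0 Dhat (refines_refl _ _)).
  - by apply: hatT; exact: leq_addr.
  - by apply: hatT; exact: leq_addr.
have early : \sum_(i < l0) #|` M i|%:R <= #|` T l0|%:R :> R.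
  rewrite -natr_sum ler_nat; apply: leq_trans (run_sum_marked run l0).
  exact: leq_addr.
have late : \sum_(i < k) #|` M (l0 + i)%N|%:R <=
    K3 * (Clin `^ s^-1 / (1 - qlin `^ s^-1) * eta (l0 + k)%N `^ (- s^-1)).
  have sum_le := linear_convergence_sum (e := fun i => eta (l0 + i)%N)
    p_gt0 qlin01 Clin_gt0 eta_gt0 lin'.
  apply: le_trans (ler_wpM2l (marking_const_ge0 _ _) sum_le).
  rewrite mulr_sumr; apply: ler_sum => i _; apply: run_card_marked; last exact: eta_i.
  by apply: hatT; exact: leq_addr.
have := ler_wpM2l Cmesh_ge0 early; have := ler_wpM2l Cmesh_ge0 late.
have n0 : 0 <= rg_Cmesh S * #|` T l0|%:R by rewrite mulr_ge0.
have := ler_wpM2l n0 b1; have := powR_ge0 (eta (l0 + k)%N) (- s^-1).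
move: closure_est b1; rewrite /rate_const -/K3; lra.
Qed.

End OptimalRate.

Theorem theorem26 (R : realType) (d : nat) (hd : (2 <= d)%N)
    (S : refinement_setting R d)
    (Cstb Cred qred Crel' Crel : R)
    (hCstb : 0 < Cstb) (hCred : 0 < Cred) (hqred : 0 < qred < 1)
    (hCrel' : 0 < Crel') (hCrel : 0 < Crel)
    (m : nat) (gamma0 Cmon : R) (hgamma0 : 0 < gamma0) (hCmon : 0 < Cmon)
    (Clin qlin : R) (hClin : 0 < Clin) (hqlin : 0 < qlin < 1)
    (Cmark : R) (hCmark : 1 <= Cmark)
    (theta : R)
    (htheta : 0 < theta < (1 + Cstb ^+ 2 * Crel ^+ 2 / gamma0 ^+ 2)^-1)
    (s : R) (hs : 0 < s) :
  exists2 Copt : nat -> \bar R -> R -> R,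
    (forall n A e, 0 < Copt n A e) &
  forall (P : problem R) (D : discretization S P),
    stability D Cstb -> reduction D Cred qred -> reliability D Crel' ->
    discrete_reliability D Crel ->
    hat_mesh_properties D m gamma0 Cmon ->
  forall (T M : nat -> mesh R d) (U : nat -> pb_H P) (eta : nat -> R),
    adaptive_run D theta Cmark T M U eta ->
    definite_on (Xinfty D T) -> Xinfty D T = [set: pb_H P] ->
  forall l3 l5 : nat,
    linear_convergence_index Clin qlin U eta l3 ->
    (forall l, (l5 <= l)%N -> refines (rg_refine S) (hatT0 S m) (T l)) ->
  let l6 := maxn l3 l5 in
  let C := Copt #|` T l6| (approx_norm D s) (est D (hatT0 S m)) in
    (approx_norm D s < +oo)%E <->
    (forall l, (l6 <= l)%N ->
       eta l <= C * (#|` T l|%:R - #|` rg_T0 S|%:R + 1) `^ (- s)).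
Proof.
exists (fun n A e => rate_const S Cstb Crel gamma0 Cmon Clin qlin Cmark theta s m
                       n (fine A) e) => [n A e|].
  exact: rate_const_gt0.
move=> P D stb _ _ rel hat T M U eta run _ _ l3 l5 [_ lin] hatT l6 C.
have hatT6 l : (l6 <= l)%N -> refines (rg_refine S) (hatT0 S m) (T l).
  by rewrite geq_max => /andP[_ /hatT].
split=> [u_As|rate].
  apply: (run_rate hCstb hCrel hgamma0 hCmon hClin hqlin hCmark htheta hs
    stb rel hat run u_As hatT6) => l n.
  by rewrite geq_max => /andP[/lin].
apply: (approx_norm_lt_pinfty run _ hs _ _ rate) => [||l /hatT6].
- by case/andP: htheta.
- exact: rate_const_gt0.
- exact: hat_has_sol hgamma0 hat _.
Qed.
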